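(* Let $r\geq 2$ be an integer. Then there exist $c,\varepsilon>0$ (depending only on $r$) such that the following holds. Let $H$ be an $r$-uniform $d$-regular hypergraph on $n$ vertices, where $d\leq \varepsilon n^{1/2}$. Then $$\mathrm{bw}(H)\leq e(H)\cdot\left(1-\frac{1}{2^{r-1}}\right)-c\sqrt{d}\,n.$$
   Context: An equipartition of a finite set is a partition into two parts whose sizes differ by at most one. A bisection of a hypergraph $H$ is an equipartition $V(H)=X\cup Y$ of its vertex set together with all edges that contain at least one vertex in each part; its size is the number of such edges. The bisection width $\mathrm{bw}(H)$ is the minimum size of a bisection of $H$. $e(H)$ denotes the number of edges of $H$. A hypergraph is $d$-regular if every vertex lies in exactly $d$ edges. *)

(* Defs.v *)
From HB Require Import structures.
From mathcomp Require Import all_boot all_order all_algebra.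
From mathcomp Require Import reals.
Set Implicit Arguments. Unset Strict Implicit. Unset Printing Implicit Defensive.

Definition hypergraph (n : nat) := {set {set 'I_n}}.

Definition uniform (n r : nat) (E : hypergraph n) : bool :=
  [forall e in E, #|e| == r].

Definition regular (n d : nat) (E : hypergraph n) : bool :=
  [forall v : 'I_n, #|[set e in E | v \in e]| == d].

Definition equipartition (n : nat) (X : {set 'I_n}) : bool :=
  (#|X| <= #|~: X|.+1) && (#|~: X| <= #|X|.+1).

Definition cut_size (n : nat) (E : hypergraph n) (X : {set 'I_n}) : nat :=
  #|[set e in E | (e :&: X != set0) && (e :\: X != set0)]|.

(* bisection width: minimum cut size over all equipartitions
   (equipartitions always exist and cut sizes are <= #|E|) *)
Definition bw (n : nat) (E : hypergraph n) : nat :=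
  \big[minn/#|E|]_(X : {set 'I_n} | equipartition X) cut_size E X.

(* Main.v *)
Require Import Defs.
From HB Require Import structures.
From mathcomp Require Import all_boot all_order all_algebra.
From mathcomp Require Import reals.
From mathcomp Require Import zify ring lra.
Import Order.TTheory GRing.Theory Num.Theory.
Local Open Scope ring_scope.
Set Implicit Arguments. Unset Strict Implicit. Unset Printing Implicit Defensive.

(** Choose an ordered pair of vertices [(p, q)] in every edge and a set [B] such
    that [p] lies in [B] and [q] outside it for at least a quarter of the edges.
    Give each vertex outside [B] a uniform random sign [x u], and give [b] in [B]
    a random sign of conditional mean [clip (L b / T b)], where [L b] is the sum of
    [x q] over the oriented edges with [p = b], and [T b] is at least [sqrt d].
    All these means are increasing in [x], so by Harris' inequality an edge is
    monochromatic with probability at least [2^(1-r) (1 + E (z p * z q))], and a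
    fourth moment estimate bounds the sum of the correlations [E (z p * z q)] below
    by a constant times [sqrt d * n].  The clipped means are Lipschitz, flipping one
    [x u] changes their sum by [O(sqrt d)], so by the Efron-Stein inequality the
    imbalance has second moment [O(d n)].  Rebalancing costs at most [d] edges per
    moved vertex, thus [O(d sqrt (d n))] in total, which is negligible against
    [sqrt d * n] when [d <= eps * sqrt n].  The final rounding is deterministic:
    the objective, with a quadratic penalty for the imbalance, is affine in each
    mean, so it does not decrease when the means are pushed to signs one by one. *)

(** * Averaging over the sign cube: monotonicity, Harris, Efron-Stein *)

Section Cube.
Variables (R : realFieldType) (V : finType).
Local Notation point := {ffun V -> R}.
Implicit Types (x y z : point) (f g : point -> R) (s : seq V) (i j u v : V).

Definition upd x i t : point := [ffun v => if v == i then t else x v].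

Lemma updE x i t v : upd x i t v = if v == i then t else x v.
Proof. by rewrite ffunE. Qed.

Lemma upd_upd x i t t' : upd (upd x i t) i t' = upd x i t'.
Proof. by apply/ffunP => v; rewrite !updE; case: eqP. Qed.

Lemma updC x i j t t' : i != j -> upd (upd x i t) j t' = upd (upd x j t') i t.
Proof.
move=> ij; apply/ffunP => v; rewrite !updE.
by case: (v =P j) => // ->; case: (j =P i) => // ji; rewrite ji eqxx in ij.
Qed.

Lemma upd_id x i : upd x i (x i) = x.
Proof. by apply/ffunP => v; rewrite updE; case: eqP => // ->. Qed.

Lemma updN x i t : - upd x i t = upd (- x) i (- t).
Proof. by apply/ffunP => v; rewrite !ffunE; case: eqP. Qed.

Lemma upd_mono x y i t : (forall v, x v <= y v) ->
  forall v, upd x i t v <= upd y i t v.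
Proof. by move=> xy v; rewrite !updE; case: eqP. Qed.

(** Averaging proceeds one coordinate at a time from an arbitrary base point, which allows induction
    on the list of coordinates. *)
Definition avg i f x : R := (f (upd x i 1) + f (upd x i (-1))) / 2.
Definition avgs s f : point -> R := foldr avg f s.

(* The expectation under a uniformly random sign vector; the base point is
   irrelevant because every coordinate gets averaged. *)
Definition expect f : R := avgs (enum V) f 0.

Lemma eq_avgs s f g : f =1 g -> avgs s f =1 avgs s g.
Proof. by move=> fg; elim: s => //= i s IH x; rewrite /avg !IH. Qed.

Lemma avgsD s f g x : avgs s (fun y => f y + g y) x = avgs s f x + avgs s g x.
Proof. by elim: s x => //= i s IH x; rewrite /avg !IH; field. Qed.

Lemma avgsZ s c f x : avgs s (fun y => c * f y) x = c * avgs s f x.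
Proof. by elim: s x => //= i s IH x; rewrite /avg !IH; field. Qed.

Lemma avgs_cst s c x : avgs s (fun=> c) x = c.
Proof. by elim: s x => //= i s IH x; rewrite /avg !IH; field. Qed.

Lemma avgsN s f x : avgs s (fun y => f (- y)) x = avgs s f (- x).
Proof.
by elim: s x => //= i s IH x; rewrite /avg !IH !updN opprK addrC.
Qed.

Definition cube x := forall v, (x v == 1) || (x v == -1).

Lemma le_avgs s f g x : (forall y, cube y -> f y <= g y) ->
  (forall v, v \notin s -> (x v == 1) || (x v == -1)) -> avgs s f x <= avgs s g x.
Proof.
move=> fg; elim: s x => /= [|i s IH] x sx; first by apply: fg => v; rewrite sx.
have H t : (t == 1) || (t == -1) -> avgs s f (upd x i t) <= avgs s g (upd x i t).
  move=> t1; apply: IH => v vs; rewrite updE; case: (v =P i) => // /eqP vi.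
  by rewrite sx // inE negb_or vi.
have := H 1; have := H (-1); rewrite !eqxx orbT => /(_ isT) h1 /(_ isT) h2.
by rewrite /avg; lra.
Qed.

Lemma le_expect f g : (forall y, cube y -> f y <= g y) -> expect f <= expect g.
Proof. by move=> fg; apply: le_avgs => // v; rewrite mem_enum. Qed.

Lemma eq_expect_cube f g : (forall y, cube y -> f y = g y) -> expect f = expect g.
Proof.
by move=> fg; apply/eqP; rewrite eq_le; apply/andP; split; apply: le_expect => y /fg ->.
Qed.

Lemma eq_expect f g : f =1 g -> expect f = expect g.
Proof. by move=> fg; apply: eq_avgs. Qed.

Lemma expectD f g : expect (fun y => f y + g y) = expect f + expect g.
Proof. exact: avgsD. Qed.

Lemma expectZ c f : expect (fun y => c * f y) = c * expect f.
Proof. exact: avgsZ. Qed.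

Lemma expect_cst c : expect (fun=> c) = c.
Proof. exact: avgs_cst. Qed.

Lemma expectB f g : expect (fun y => f y - g y) = expect f - expect g.
Proof.
rewrite -[- expect g]mulN1r -expectZ -expectD.
by apply: eq_expect => y; rewrite mulN1r.
Qed.

Lemma expect_opp f : expect (fun y => f (- y)) = expect f.
Proof. by rewrite /expect avgsN oppr0. Qed.

Lemma expect_sum (I : Type) (r : seq I) (P : pred I) (F : I -> point -> R) :
  expect (fun y => \sum_(k <- r | P k) F k y) = \sum_(k <- r | P k) expect (F k).
Proof.
elim: r => [|k r IH].
  by rewrite big_nil -[RHS](expect_cst 0); apply: eq_expect => y; rewrite big_nil.
rewrite big_cons -IH; case: ifP => Pk; rewrite -?expectD; apply: eq_expect => y;
  by rewrite big_cons Pk.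
Qed.

Lemma expect_odd f : (forall x, f (- x) = - f x) -> expect f = 0.
Proof.
move=> fN; have : expect f = - expect f.
  by rewrite -{1}expect_opp -mulN1r -expectZ; apply: eq_expect => y; rewrite mulN1r.
lra.
Qed.

Lemma expect_attained f : exists x, expect f <= f x.
Proof.
rewrite /expect; elim: (enum V) 0 => [|i s IH] x /=; first by exists x.
rewrite /avg; case: (IH (upd x i 1)) => y1 h1; case: (IH (upd x i (-1))) => y2 h2.
case: (leP (f y1) (f y2)) => h; [exists y2|exists y1]; lra.
Qed.

Definition increasing f := forall x y, (forall v, x v <= y v) -> f x <= f y.

Lemma avgs_increasing s f : increasing f -> increasing (avgs s f).
Proof.
move=> fi; elim: s => //= i s IH x y xy; rewrite /avg.
have := IH _ _ (upd_mono i 1 xy); have := IH _ _ (upd_mono i (-1) xy); lra.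
Qed.

(** Chebyshev's inequality in the coordinate [i]: both partial averages are at least as large at [1]
    as at [-1], so the product of their differences is nonnegative. *)
Lemma avgs_harris s f g x : increasing f -> increasing g ->
  avgs s f x * avgs s g x <= avgs s (fun y => f y * g y) x.
Proof.
move=> fi gi; elim: s x => //= i s IH x; rewrite /avg.
have le1 : forall v, upd x i (-1) v <= upd x i 1 v.
  by move=> v; rewrite !updE; case: eqP => // _; lra.
have := avgs_increasing s fi le1; have := avgs_increasing s gi le1.
have := IH (upd x i 1); have := IH (upd x i (-1)); nra.
Qed.

Lemma expect_harris f g : increasing f -> increasing g ->
  expect f * expect g <= expect (fun y => f y * g y).
Proof. exact: avgs_harris. Qed.

Lemma increasing_prod (s : seq V) (F : V -> point -> R) :
  (forall v x, 0 <= F v x) -> (forall v, increasing (F v)) ->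
  increasing (fun x => \prod_(v <- s) F v x).
Proof.
move=> F0 Fi; elim: s => [|v s IH] x y xy; first by rewrite !big_nil.
rewrite !big_cons; apply: ler_pM => //; [exact: prodr_ge0|exact: Fi|exact: IH].
Qed.

Lemma expect_prod_ge (s : seq V) (F : V -> point -> R) :
  (forall v x, 0 <= F v x) -> (forall v, increasing (F v)) ->
  \prod_(v <- s) expect (F v) <= expect (fun x => \prod_(v <- s) F v x).
Proof.
move=> F0 Fi; elim: s => [|v s IH].
  by rewrite big_nil (eq_expect (g := fun=> 1)) ?expect_cst // => x; rewrite big_nil.
rewrite big_cons.
have -> : expect (fun x => \prod_(u <- v :: s) F u x)
    = expect (fun x => F v x * \prod_(u <- s) F u x).
  by apply: eq_expect => x; rewrite big_cons.
apply: le_trans (expect_harris (Fi v) (increasing_prod s F0 Fi)).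
apply: ler_wpM2l IH.
by rewrite -(expect_cst 0); apply: le_expect.
Qed.

(** With [a] and [b] the averages at the two signs, the mean of the squares is the square of the
    mean plus [((a - b) / 2) ^+ 2]. Averaging preserves the bound on differences, so the last term
    is at most [C i ^+ 2]. *)
Lemma avgs_efron_stein s f (C : V -> R) x :
  (forall i y, `|f (upd y i 1) - f (upd y i (-1))| <= 2 * C i) ->
  avgs s (fun y => f y ^+ 2) x <= avgs s f x ^+ 2 + \sum_(i <- s) C i ^+ 2.
Proof.
move=> fC.
have lip s' i y : `|avgs s' f (upd y i 1) - avgs s' f (upd y i (-1))| <= 2 * C i.
  elim: s' y => //= j s' IH y; rewrite /avg.
  case: (i =P j) => [->|/eqP ij].
    rewrite !upd_upd subrr normr0; exact: le_trans (normr_ge0 _) (fC j y).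
  rewrite !(updC _ _ _ ij).
  have := IH (upd y j 1); have := IH (upd y j (-1)).
  rewrite !ler_norml => /andP[? ?] /andP[? ?]; apply/andP; split; lra.
elim: s x => [|i s IH] x; first by rewrite big_nil addr0.
rewrite big_cons /= /avg.
have := lip s i x; rewrite ler_norml => /andP[].
have := IH (upd x i 1); have := IH (upd x i (-1)).
set a := avgs s f _; set b := avgs s f _; set S := \sum_(_ <- _) _.
set p := avgs s _ _; set q := avgs s _ _ => h1 h2 h3 h4.
have : 0 <= (2 * C i - (a - b)) * (2 * C i + (a - b)) by apply: mulr_ge0; lra.
nra.
Qed.

Lemma expect_sqr_le f (C : V -> R) :
  (forall i y, `|f (upd y i 1) - f (upd y i (-1))| <= 2 * C i) ->
  expect f = 0 -> expect (fun y => f y ^+ 2) <= \sum_i C i ^+ 2.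
Proof.
move=> fC f0; apply: le_trans (avgs_efron_stein _ _ fC) _.
by rewrite -/(expect f) f0 expr0n /= add0r big_enum.
Qed.

(** * Second and fourth moments of linear forms in random signs *)

Section Linear.
Variable a : V -> R.
Definition lin x := \sum_v a v * x v.

Lemma lin_upd x i t : lin (upd x i t) = lin x + a i * (t - x i).
Proof.
rewrite /lin (bigD1 i) //= [in RHS](bigD1 i) //= updE eqxx.
rewrite (eq_bigr (fun v => a v * x v)); first by ring.
by move=> v /negPf vi; rewrite updE vi.
Qed.

Lemma linN x : lin (- x) = - lin x.
Proof. by rewrite /lin -sumrN; apply: eq_bigr => v _; rewrite ffunE mulrN. Qed.

Lemma lin0 : lin 0 = 0.
Proof. by rewrite /lin big1 // => v _; rewrite ffunE mulr0. Qed.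

(** The induction keeps pending coordinates at zero in the base point, so [lin x] is the part
    already fixed; cross terms cancel between the two signs. *)
Lemma expect_lin2 : expect (fun x => lin x ^+ 2) = \sum_v a v ^+ 2.
Proof.
suff H s x : uniq s -> (forall v, v \in s -> x v = 0) ->
    avgs s (fun y => lin y ^+ 2) x = lin x ^+ 2 + \sum_(v <- s) a v ^+ 2.
  by rewrite /expect H ?enum_uniq ?lin0 ?expr0n ?add0r ?big_enum // => v _; rewrite ffunE.
elim: s x => [|i s IH] x; first by rewrite big_nil addr0.
rewrite cons_uniq => /andP[is_ us] x0; rewrite big_cons /= /avg.
have xi : x i = 0 by apply: x0; rewrite inE eqxx.
have xs t v : v \in s -> upd x i t v = 0.
  move=> vs; rewrite updE; case: eqP => [vi|_]; first by rewrite -vi vs in is_.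
  by apply: x0; rewrite inE vs orbT.
by rewrite (IH _ us (xs 1)) (IH _ us (xs (-1))) !lin_upd xi; field.
Qed.

(** The odd terms of [(l + c) ^+ 4] and [(l - c) ^+ 4] cancel, leaving
    [l ^+ 4 + 6 * l ^+ 2 * c ^+ 2 + c ^+ 4]; the induction closes with slack [2 * c ^+ 4]. *)
Lemma expect_lin4 : expect (fun x => lin x ^+ 4) <= 3 * (\sum_v a v ^+ 2) ^+ 2.
Proof.
suff H s x : uniq s -> (forall v, v \in s -> x v = 0) ->
    avgs s (fun y => lin y ^+ 4) x <= lin x ^+ 4
      + 6 * lin x ^+ 2 * (\sum_(v <- s) a v ^+ 2) + 3 * (\sum_(v <- s) a v ^+ 2) ^+ 2.
  apply: le_trans (H _ _ (enum_uniq V) _) _; first by move=> v _; rewrite ffunE.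
  by rewrite lin0 !expr0n /= mulr0 mul0r !add0r big_enum.
elim: s x => [|i s IH] x; first by rewrite big_nil expr0n !mulr0 !addr0.
rewrite cons_uniq => /andP[is_ us] x0; rewrite big_cons /= /avg.
have xi : x i = 0 by apply: x0; rewrite inE eqxx.
have xs t v : v \in s -> upd x i t v = 0.
  move=> vs; rewrite updE; case: eqP => [vi|_]; first by rewrite -vi vs in is_.
  by apply: x0; rewrite inE vs orbT.
have := IH _ us (xs 1); have := IH _ us (xs (-1)); rewrite !lin_upd xi.
set S := \sum_(_ <- _) _; set p := avgs _ _ _; set q := avgs _ _ _; set l := lin x.
move: (a i) => c h1 h2.
have : 0 <= c ^+ 4 by rewrite exprn_even_ge0.
lra.
Qed.
End Linear.

(** * Multiaffine functions and deterministic rounding *)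

Definition multiaffine f := forall x i, exists p q, forall t, f (upd x i t) = p + q * t.

Lemma multiaffine_cst c : multiaffine (fun=> c).
Proof. by move=> x i; exists c, 0 => t; ring. Qed.

Lemma multiaffineD f g : multiaffine f -> multiaffine g ->
  multiaffine (fun x => f x + g x).
Proof.
move=> fa ga x i; have [p [q pq]] := fa x i; have [p' [q' pq']] := ga x i.
by exists (p + p'), (q + q') => t; rewrite pq pq'; ring.
Qed.

Lemma multiaffineZ c f : multiaffine f -> multiaffine (fun x => c * f x).
Proof.
move=> fa x i; have [p [q pq]] := fa x i.
by exists (c * p), (c * q) => t; rewrite pq; ring.
Qed.

Lemma multiaffine_sum (I : Type) (r : seq I) (P : pred I) (F : I -> point -> R) :
  (forall k, P k -> multiaffine (F k)) ->
  multiaffine (fun x => \sum_(k <- r | P k) F k x).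
Proof.
move=> Fa x i; elim: r => [|k r [p [q pq]]].
  by exists 0, 0 => t; rewrite big_nil; ring.
case: (boolP (P k)) => Pk; last first.
  by exists p, q => t; rewrite big_cons (negPf Pk).
have [p' [q' pq']] := Fa k Pk x i.
by exists (p' + p), (q' + q) => t; rewrite big_cons Pk pq pq'; ring.
Qed.

Lemma multiaffine_prod (A : {set V}) (al be : R) :
  multiaffine (fun x => \prod_(v in A) (al + be * x v)).
Proof.
move=> x i; case: (boolP (i \in A)) => iA; last first.
  exists (\prod_(v in A) (al + be * x v)), 0 => t; rewrite mul0r addr0.
  by apply: eq_bigr => v vA; rewrite updE; case: eqP => // vi; rewrite -vi vA in iA.
set c := \prod_(v in A | v != i) (al + be * x v).
exists (al * c), (be * c) => t; rewrite (bigD1 i) //= updE eqxx.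
rewrite (eq_bigr (fun v => al + be * x v)) -/c; first by ring.
by move=> v /andP[_ /negPf vi]; rewrite updE vi.
Qed.

Lemma multiaffine_mul2 (u v : V) (al be al' be' : R) : u != v ->
  multiaffine (fun x => (al + be * x u) * (al' + be' * x v)).
Proof.
move=> uv x i; case: (eqVneq u i) => [ui|ui]; last first.
  case: (eqVneq v i) => vi.
    exists ((al + be * x u) * al'), ((al + be * x u) * be') => t.
    by rewrite !updE vi eqxx (negPf ui); ring.
  exists ((al + be * x u) * (al' + be' * x v)), 0 => t.
  by rewrite !updE (negPf ui) (negPf vi); ring.
subst i; exists (al * (al' + be' * x v)), (be * (al' + be' * x v)) => t.
by rewrite !updE eqxx eq_sym (negPf uv); ring.
Qed.

(** An affine function on [[-1, 1]] is maximal at an endpoint, selected by the sign of the slope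
    [q]; coordinates are rounded in turn. *)
Lemma multiaffine_round f z : multiaffine f ->
  (forall v, -1 <= z v <= 1) -> exists2 y, cube y & f z <= f y.
Proof.
move=> fa z1.
suff [y [y1 ys fy]] : exists y, [/\ forall v, -1 <= y v <= 1,
    forall v, v \in enum V -> (y v == 1) || (y v == -1) & f z <= f y].
  by exists y => // v; apply: ys; rewrite mem_enum.
elim: (enum V) => [|i s [y [y1 ys fy]]]; first by exists z.
have key t : (t == 1) || (t == -1) -> f y <= f (upd y i t) ->
   exists y, [/\ forall v, -1 <= y v <= 1,
    forall v, v \in i :: s -> (y v == 1) || (y v == -1) & f z <= f y].
  move=> t1 ft; exists (upd y i t); split; last exact: le_trans ft.
    move=> v; rewrite updE; case: eqP => // _.
    by case/orP: t1 => /eqP ->; apply/andP; split; lra.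
  by move=> v; rewrite updE inE; case: (v =P i) => //= _; apply: ys.
have [p [q pq]] := fa y i.
have fyE : f y = p + q * y i by rewrite -[in LHS](upd_id y i) pq.
have /andP[yi1 yi2] := y1 i.
case: (lerP 0 q) => q0.
  by apply: (key 1); rewrite ?eqxx // fyE pq; nra.
by apply: (key (-1)); rewrite ?eqxx ?orbT // fyE pq; nra.
Qed.

End Cube.

(** * Truncation to the interval from -1 to 1 *)

Section Clip.
Variable R : realFieldType.
Implicit Types s t T : R.

Definition clip t : R := if t <= -1 then -1 else if 1 <= t then 1 else t.

Lemma clip_bound t : -1 <= clip t <= 1.
Proof. by rewrite /clip; case: (leP t (-1)) => h; [lra|case: (leP 1 t) => h'; lra]. Qed.

Lemma clip_le s t : s <= t -> clip s <= clip t.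
Proof.
by move=> st; rewrite /clip; case: (leP s (-1)) => h1; case: (leP t (-1)) => h2;
  case: (leP 1 s) => h3; case: (leP 1 t) => h4; lra.
Qed.

Lemma clipN t : clip (- t) = - clip t.
Proof.
by rewrite /clip; case: (leP t (-1)) => h1; case: (leP (- t) (-1)) => h2;
  case: (leP 1 t) => h3; case: (leP 1 (- t)) => h4; lra.
Qed.

Lemma clip_lip s t : `|clip s - clip t| <= `|s - t|.
Proof.
wlog st : s t / s <= t => [H|].
  by case: (leP s t) => [|/ltW] /H //; rewrite distrC [X in _ <= X]distrC.
rewrite distrC [X in _ <= X]distrC !ger0_norm ?subr_ge0 ?clip_le //.
by rewrite /clip; case: (leP s (-1)) => h1; case: (leP t (-1)) => h2;
  case: (leP 1 s) => h3; case: (leP 1 t) => h4; lra.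
Qed.

Lemma clip_sign t : (t == 1) || (t == -1) -> clip t = t.
Proof.
case/orP => /eqP ->; rewrite /clip lexx //.
by case: (leP 1 (-1 : R)) => h; lra.
Qed.

(** A polynomial lower bound, so that the second and fourth moments suffice to bound the correlation
    from below. *)
Lemma clip_mul_ge T s : 0 < T -> s ^+ 2 / T - s ^+ 4 / (4 * T ^+ 3) <= s * clip (s / T).
Proof.
move=> T0; have Tn : T != 0 by rewrite gt_eqF.
have -> : s ^+ 2 / T - s ^+ 4 / (4 * T ^+ 3) = T * ((s / T) ^+ 2 - (s / T) ^+ 4 / 4).
  by field; rewrite Tn.
have -> : s * clip (s / T) = T * (s / T * clip (s / T)) by field.
rewrite ler_pM2l //; set t := s / T.
have t4 : 0 <= t ^+ 4 by rewrite exprn_even_ge0.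
have big (u : R) : 1 <= u -> u ^+ 2 - u ^+ 4 / 4 <= u.
  move=> u1; have : 0 <= u * ((u - 6 / 5) ^+ 2 * (u + 12 / 5)).
    by apply: mulr_ge0; [lra|apply: mulr_ge0; [exact: sqr_ge0|lra]].
  nra.
rewrite /clip; case: (leP t (-1)) => h; last case: (leP 1 t) => h'.
- by have := big (- t); rewrite sqrrN exprNn -signr_odd expr0 mul1r; lra.
- by rewrite mulr1; exact: big.
- by lra.
Qed.
End Clip.

(** * Clipped linear means: positive correlation and variance *)

Section Smooth.
Variables (R : realFieldType) (V : finType).
Local Notation point := {ffun V -> R}.
Implicit Types (x y z : point) (e : {set V}) (u v p q : V).

(* The probability that [e] is monochromatic when the signs of its vertices are
   independent with means [z]. *)
Definition mono_prob e z : R :=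
  \prod_(v in e) (1 / 2 + 1 / 2 * z v) + \prod_(v in e) (1 / 2 + - (1 / 2) * z v).

Lemma multiaffine_mono_prob e : multiaffine (mono_prob e).
Proof. by apply: multiaffineD; apply: multiaffine_prod. Qed.

Variable a : V -> V -> R.
Hypothesis a_ge0 : forall v u, 0 <= a v u.

(** Row [a v] holds the weights of the field at [v]. Nonnegative weights make each mean increasing,
    and oddness makes it centred. *)
Definition smooth x : point := [ffun v => clip (lin (a v) x)].

Lemma smoothE x v : smooth x v = clip (lin (a v) x).
Proof. by rewrite ffunE. Qed.

Lemma smooth_bound x v : -1 <= smooth x v <= 1.
Proof. by rewrite smoothE clip_bound. Qed.

Lemma smooth_increasing v : increasing (fun x => smooth x v).
Proof.
move=> x y xy; rewrite !smoothE; apply: clip_le; apply: ler_sum => u _.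
exact: ler_wpM2l.
Qed.

Lemma smoothN x : smooth (- x) = - smooth x.
Proof. by apply/ffunP => v; rewrite !ffunE linN clipN. Qed.

Lemma expect_smooth v : expect (fun x => smooth x v) = 0.
Proof. by apply: expect_odd => x; rewrite smoothN ffunE. Qed.

Lemma expect_smooth_mul_ge0 u v : 0 <= expect (fun x => smooth x u * smooth x v).
Proof.
by have := expect_harris (smooth_increasing u) (smooth_increasing v);
  rewrite !expect_smooth mulr0.
Qed.

Lemma expect_half_smooth v : expect (fun x => 1 / 2 + 1 / 2 * smooth x v) = 1 / 2.
Proof. by rewrite expectD expect_cst expectZ expect_smooth mulr0 addr0. Qed.

(** The symmetry [x -> - x] equates the expectations of the two products. Harris' inequality
    separates the factors of [p] and [q] from the rest, whose factors each have expectation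
    [1 / 2]. *)
Lemma expect_mono_prob_ge e p q : p \in e -> q \in e -> p != q ->
  2 * (1 / 2) ^+ #|e| * (1 + expect (fun x => smooth x p * smooth x q))
    <= expect (fun x => mono_prob e (smooth x)).
Proof.
move=> pe qe pq; rewrite /mono_prob expectD.
have -> : expect (fun x => \prod_(v in e) (1 / 2 + - (1 / 2) * smooth x v))
    = expect (fun x => \prod_(v in e) (1 / 2 + 1 / 2 * smooth x v)).
  rewrite -expect_opp; apply: eq_expect => x; apply: eq_bigr => v _.
  by rewrite smoothN ffunE; ring.
pose F v x := 1 / 2 + 1 / 2 * smooth x v.
have F0 v x : 0 <= F v x by have /andP[? ?] := smooth_bound x v; rewrite /F; lra.
have Fi v : increasing (F v).
  by move=> x y xy; have := smooth_increasing v xy; rewrite /F /=; lra.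
pose A := e :\ p :\ q.
have Ae : #|e| = #|A|.+2.
  by rewrite (cardsD1 p) pe (cardsD1 q) !inE qe eq_sym pq.
have -> : expect (fun x => \prod_(v in e) (1 / 2 + 1 / 2 * smooth x v))
    = expect (fun x => (F p x * F q x) * \prod_(v <- enum A) F v x).
  apply: eq_expect => x; rewrite big_enum (big_setD1 p pe) (big_setD1 q) /= ?mulrA //.
  by rewrite !inE qe eq_sym pq.
have Fpqi : increasing (fun x => F p x * F q x).
  by move=> x y xy; apply: ler_pM => //; apply: Fi.
have := expect_harris Fpqi (increasing_prod (enum A) F0 Fi).
have := expect_prod_ge (enum A) F0 Fi.
rewrite (eq_bigr (fun=> 1 / 2)); last by move=> v _; exact: expect_half_smooth.
rewrite big_const_seq count_predT -cardE iter_mulr_1.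
have -> : expect (fun x => F p x * F q x)
   = 1 / 4 * (1 + expect (fun x => smooth x p * smooth x q)).
  rewrite (eq_expect (g := fun x => 1 / 4 + (1 / 4 * smooth x p + (1 / 4 * smooth x q +
     1 / 4 * (smooth x p * smooth x q))))); last by move=> x; rewrite /F; field.
  by rewrite !expectD !expectZ expect_cst !expect_smooth; ring.
have := expect_smooth_mul_ge0 p q; rewrite Ae !exprS.
set m := expect _; set h := _ ^+ _; set g := expect _; set k := expect _ => m0 hg mk.
have : 1 / 4 * (1 + m) * h <= 1 / 4 * (1 + m) * g by apply: ler_wpM2l hg; lra.
lra.
Qed.

(** Flipping the sign [i] moves each clipped mean by at most [2 * a v i], so Efron-Stein applies
    with the column sums as constants. *)
Lemma expect_sum_smooth_sqr_le :
  expect (fun x => (\sum_v smooth x v) ^+ 2) <= \sum_i (\sum_v a v i) ^+ 2.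
Proof.
apply: expect_sqr_le => [i y|]; last first.
  by rewrite expect_sum big1 // => v _; exact: expect_smooth.
rewrite -sumrB mulr_sumr; apply: le_trans (ler_norm_sum _ _ _) _.
apply: ler_sum => v _; rewrite !smoothE; apply: le_trans (clip_lip _ _) _.
rewrite !lin_upd.
have -> : lin (a v) y + a v i * (1 - y i) - (lin (a v) y + a v i * (-1 - y i))
   = 2 * a v i by ring.
by rewrite ger0_norm // mulr_ge0.
Qed.

End Smooth.

(** With [W] the sum of squares, the moments give at least [W / T - 3 * W ^+ 2 / (4 * T ^+ 3)], and
    [W <= T ^+ 2] leaves a quarter of the main term. *)
Lemma expect_lin_clip_ge (R : realFieldType) (V : finType) (w : V -> R) (T : R) :
  0 < T -> \sum_u w u ^+ 2 <= T ^+ 2 ->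
  (\sum_u w u ^+ 2) / (4 * T) <= expect (fun x => lin w x * clip (lin w x / T)).
Proof.
move=> T0 WT; have Tn : T != 0 by rewrite gt_eqF.
apply: (@le_trans _ _ (expect (fun x => T^-1 * lin w x ^+ 2
   + - (4 * T ^+ 3)^-1 * lin w x ^+ 4))); last first.
  apply: le_expect => x _; apply: le_trans (clip_mul_ge _ T0).
  by rewrite [_^-1 * _]mulrC mulNr [X in _ - X]mulrC.
rewrite expectD !expectZ expect_lin2 mulNr.
have := expect_lin4 w; set W := \sum_u _ in WT *; set M := expect _ => MW.
have W0 : 0 <= W by apply: sumr_ge0 => u _; exact: sqr_ge0.
have T3 : 0 < 4 * T ^+ 3 by rewrite mulr_gt0 // exprn_gt0.
rewrite -subr_ge0.
have -> : T^-1 * W - (4 * T ^+ 3)^-1 * M - W / (4 * T)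
   = (4 * T ^+ 3)^-1 * (3 * T ^+ 2 * W - M) by field; rewrite Tn.
apply: mulr_ge0; first by rewrite invr_ge0 ltW.
have : W * W <= T ^+ 2 * W by apply: ler_wpM2r.
lra.
Qed.

(** * Oriented edges and the bias they induce *)

Section Bias.
Variables (R : rcfType) (V : finType) (E : {set {set V}}) (r d : nat).
Hypothesis E_card : forall e, e \in E -> #|e| = r.
Hypothesis E_deg : forall v, #|[set e in E | v \in e]| = d.
Hypothesis d_gt0 : (0 < d)%N.
Variable pq : {set V} -> V * V.
Local Notation p e := (pq e).1.
Local Notation q e := (pq e).2.
Hypothesis pqE : forall e, e \in E -> [/\ p e \in e, q e \in e & p e != q e].

(** A uniformly random [B] works for each edge with probability [1 / 4]. This expectation is
    multiaffine in the means, so rounding from the zero vector finds [B]. *)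
Lemma exists_oriented_half : exists B : {set V},
  #|E|%:R / 4 <= #|[set e in E | (p e \in B) && (q e \notin B)]|%:R :> R.
Proof.
pose f (x : {ffun V -> R}) :=
  \sum_(e in E) (1 / 2 + 1 / 2 * x (p e)) * (1 / 2 + - (1 / 2) * x (q e)).
have fa : multiaffine f.
  by apply: multiaffine_sum => e /pqE[_ _ pqe]; apply: multiaffine_mul2.
have [|y cy fy] := @multiaffine_round _ _ f 0 fa.
  by move=> v; rewrite ffunE; apply/andP; split; lra.
exists [set v | y v == 1].
have f0 : f 0 = #|E|%:R / 4.
  rewrite /f (eq_bigr (fun=> 1 / 4)); last by move=> e _; rewrite !ffunE; field.
  by rewrite sumr_const -mulr_natl; field.
rewrite -f0; apply: le_trans fy _.
rewrite -sum1_card natr_sum [X in _ <= X]big_mkcond /f [X in X <= _]big_mkcond /=.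
apply: ler_sum => e _; rewrite !inE; case: (e \in E) => //=.
have n1 : (-1 == 1 :> R) = false by rewrite lt_eqF //; lra.
by case/orP: (cy (p e)) => /eqP ->; case/orP: (cy (q e)) => /eqP ->;
  rewrite ?eqxx ?n1 /=; lra.
Qed.

Variable B : {set V}.
Let G := [set e in E | (p e \in B) && (q e \notin B)].
(** Several edges may carry the same ordered pair, hence a multiplicity. *)
Definition wt (b u : V) : R := #|[set e in G | (p e == b) && (q e == u)]|%:R.

Lemma sum_wt (phi : V -> V -> R) :
  \sum_(e in G) phi (p e) (q e) = \sum_b \sum_u wt b u * phi b u.
Proof.
rewrite (partition_big (fun e => p e) xpredT) //=; apply: eq_bigr => b _.
rewrite (partition_big (fun e => q e) xpredT) //=; apply: eq_bigr => u _.
rewrite (eq_bigr (fun=> phi b u)); last by move=> e /andP[/andP[_ /eqP ->] /eqP ->].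
rewrite sumr_const -mulr_natl; congr (_%:R * _).
by apply: eq_card => e; rewrite [LHS]unfold_in [RHS]inE andbA.
Qed.

Lemma wt_ge0 b u : 0 <= wt b u.
Proof. exact: ler0n. Qed.

Lemma wt_eq0 b u : ~~ ((b \in B) && (u \notin B)) -> wt b u = 0.
Proof.
move=> bu; rewrite /wt (_ : [set _ in _ | _] = set0) ?cards0 //.
apply/setP => e; rewrite !inE; apply/negP.
by move=> /andP[/andP[_ H] /andP[/eqP pb /eqP qu]]; rewrite pb qu in H; rewrite H in bu.
Qed.

Lemma sum_oriented_le (P : pred {set V}) v : (forall e, e \in G -> P e -> v \in e) ->
  \sum_(e in G) (P e)%:R <= d%:R :> R.
Proof.
move=> Pv; rewrite -(E_deg v) -sum1_card natr_sum.
rewrite big_mkcond [X in _ <= X]big_mkcond /=; apply: ler_sum => e _.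
have := Pv e; rewrite !inE; case: (e \in E) => //=.
case: (_ && _) => [/(_ isT)|_]; last by case: ifP.
by case: (P e) => [/(_ isT) ->|_] //; case: ifP.
Qed.

Lemma sum_wtl_le u : \sum_b wt b u <= d%:R.
Proof.
rewrite (eq_bigr (fun b => \sum_u' wt b u' * (u' == u)%:R)); last first.
  move=> b _; rewrite (bigD1 u) //= eqxx mulr1 big1 ?addr0 // => v /negPf ->.
  by rewrite mulr0.
rewrite -(sum_wt (fun _ u' => (u' == u)%:R)); apply: (@sum_oriented_le _ u) => e.
by rewrite !inE => /andP[/pqE[_ qe _] _] /eqP <-.
Qed.

Lemma sum_wtr_le b : \sum_u wt b u <= d%:R.
Proof.
rewrite (_ : \sum_u _ = \sum_b' \sum_u wt b' u * (b' == b)%:R); last first.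
  rewrite [RHS](bigD1 b) //= [X in _ = _ + X]big1 => [|v /negPf ->]; last first.
    by rewrite big1 // => u _; rewrite mulr0.
  by rewrite addr0; apply: eq_bigr => u _; rewrite eqxx mulr1.
rewrite -(sum_wt (fun b' _ => (b' == b)%:R)); apply: (@sum_oriented_le _ b) => e.
by rewrite !inE => /andP[/pqE[pe _ _] _] /eqP <-.
Qed.

Let W b := \sum_u wt b u ^+ 2.
Let T b := Num.sqrt (d%:R + W b).

(* Vertices outside [B] keep their random sign, while those in [B] follow the
   field exerted by their partners outside [B].  Adding [d] under the square root
   keeps the column sums of order [sqrt d]. *)
Definition bias v u : R := if v \in B then wt v u / T v else (v == u)%:R.

Lemma wt_sqr_ge0 b : 0 <= W b.
Proof. by apply: sumr_ge0 => u _; exact: sqr_ge0. Qed.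

Lemma natr_d_gt0 : 0 < d%:R :> R.
Proof. by rewrite ltr0n. Qed.

Lemma scale_sqr b : T b ^+ 2 = d%:R + W b.
Proof. by rewrite sqr_sqrtr // addr_ge0 ?wt_sqr_ge0. Qed.

Lemma scale_gt0 b : 0 < T b.
Proof. by rewrite sqrtr_gt0 ltr_wpDr ?wt_sqr_ge0 ?natr_d_gt0. Qed.

Lemma sqrt_d_le_scale b : Num.sqrt d%:R <= T b.
Proof. by rewrite ler_sqrt ?lerDl ?wt_sqr_ge0 // addr_ge0 ?wt_sqr_ge0. Qed.

Lemma sqrt_d_ge1 : 1 <= Num.sqrt d%:R :> R.
Proof. by rewrite -[X in X <= _]sqrtr1 ler_sqrt ?ler1n. Qed.

Lemma bias_ge0 v u : 0 <= bias v u.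
Proof.
rewrite /bias; case: ifP => _; last exact: ler0n.
by rewrite divr_ge0 ?wt_ge0 // ltW ?scale_gt0.
Qed.

(** Vertices in [B] contribute at most [d / sqrt d], and the diagonal entry at most
    [1 <= sqrt d]. *)
Lemma sum_bias_le i : \sum_v bias v i <= 2 * Num.sqrt d%:R.
Proof.
have sd0 : 0 < Num.sqrt d%:R :> R by rewrite sqrtr_gt0 natr_d_gt0.
apply: (@le_trans _ _ (\sum_v (wt v i / Num.sqrt d%:R + (v == i)%:R))).
  apply: ler_sum => v _; rewrite /bias; case: ifP => _; last first.
    by rewrite lerDr divr_ge0 ?wt_ge0 // ltW.
  rewrite -[X in X <= _]addr0; apply: lerD; last exact: ler0n.
  by apply: ler_wpM2l; rewrite ?wt_ge0 // lef_pV2 ?posrE ?scale_gt0 // sqrt_d_le_scale.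
rewrite big_split /= -mulr_suml [X in _ + X <= _](bigD1 i) //= eqxx /=.
rewrite [X in _ + (_ + X) <= _]big1 ?addr0; last by move=> v /negPf ->.
have : (\sum_v wt v i) / Num.sqrt d%:R <= Num.sqrt d%:R.
  by rewrite ler_pdivrMr // -expr2 sqr_sqrtr ?ler0n // sum_wtl_le.
have := sqrt_d_ge1; lra.
Qed.

Lemma sum_wt_le_sqr b : \sum_u wt b u <= W b.
Proof.
apply: ler_sum => u _; rewrite /wt -natrX ler_nat.
by case: #|_| => // k; rewrite leq_pmulr.
Qed.

(** The row sum [D] is at most [d], and at most [w] since multiplicities are integers. Hence
    [D ^+ 2 * (d + w) <= 2 * w ^+ 2 * d], and [sqrt 2 <= 3 / 2] turns the 4 into a 6. *)
Lemma wt_sqr_div_scale_ge b : (\sum_u wt b u) / (6 * Num.sqrt d%:R) <= W b / (4 * T b).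
Proof.
have sd0 : 0 < Num.sqrt d%:R :> R by rewrite sqrtr_gt0 natr_d_gt0.
have T0 := scale_gt0 b; have D0 : 0 <= \sum_u wt b u by apply: sumr_ge0 => u _; exact: wt_ge0.
have := sum_wt_le_sqr b; have := sum_wtr_le b; have := wt_sqr_ge0 b.
set D := \sum_u _ in D0 *; set w := W b => w0 Dd Dw.
rewrite ler_pdivrMr ?mulr_gt0 // mulrAC ler_pdivlMr ?mulr_gt0 //.
have : D * T b <= 3 / 2 * (w * Num.sqrt d%:R); last by lra.
rewrite -ler_sqr ?nnegrE; last 2 first.
- by rewrite mulr_ge0 // ltW.
- by rewrite !mulr_ge0 // ?ltW //; lra.
rewrite !exprMn scale_sqr -/w sqr_sqrtr ?ler0n //.
have DD : D * D <= w * d%:R by apply: ler_pM.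
have DD' : D * D <= w * w by apply: ler_pM.
have : (D * D) * d%:R <= (w * w) * d%:R by apply: ler_wpM2r; rewrite ?ler0n.
have : (D * D) * w <= (w * d%:R) * w by apply: ler_wpM2r.
have : 0 <= (w * w) * d%:R by rewrite !mulr_ge0.
rewrite !expr2; lra.
Qed.

Let Z := smooth bias.

(** Grouping the edges by [b = p e] gives the field [lin (wt b) x] times its own clipping, because
    on the cube [Z x u = x u] outside [B]. *)
Lemma sum_expect_pairs_ge :
  #|G|%:R / (6 * Num.sqrt d%:R)
    <= \sum_(e in G) expect (fun x => Z x (p e) * Z x (q e)).
Proof.
rewrite (sum_wt (fun b u => expect (fun x => Z x b * Z x u))).
have -> : #|G|%:R = \sum_b \sum_u wt b u.
  rewrite -sum1_card natr_sum (sum_wt (fun _ _ => 1)).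
  by apply: eq_bigr => b _; apply: eq_bigr => u _; rewrite mulr1.
rewrite mulr_suml; apply: ler_sum => b _.
case: (boolP (b \in B)) => bB; last first.
  rewrite !big1 ?mul0r // => u _; rewrite wt_eq0 ?mul0r // ?negb_and ?bB //.
apply: le_trans (wt_sqr_div_scale_ge b) _.
apply: le_trans (expect_lin_clip_ge (scale_gt0 b) _) _.
  by rewrite scale_sqr lerDr ler0n.
rewrite le_eqVlt; apply/orP; left; apply/eqP.
transitivity (expect (fun x => \sum_u wt b u * (Z x b * Z x u))); last first.
  by rewrite expect_sum; apply: eq_bigr => u _; rewrite expectZ.
apply: eq_expect_cube => x cx.
rewrite (eq_bigr (fun u => wt b u * x u * Z x b)); last first.
  move=> u _; case: (boolP (u \in B)) => uB.
    by rewrite wt_eq0 ?mul0r // uB andbF.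
  rewrite [Z x u]smoothE.
  have -> : lin (bias u) x = x u.
    rewrite /lin (bigD1 u) //= /bias (negPf uB) eqxx mul1r big1 ?addr0 // => v.
    by rewrite eq_sym => /negPf ->; rewrite mul0r.
  by rewrite clip_sign //; ring.
rewrite -mulr_suml; congr (_ * _); rewrite /Z smoothE; congr clip.
rewrite /lin mulr_suml; apply: eq_bigr => u _; rewrite /bias bB.
by rewrite mulrAC.
Qed.

Lemma sum_expect_mono_prob_ge : #|E|%:R / 4 <= #|G|%:R :> R ->
  2 * (1 / 2) ^+ r * (#|E|%:R + #|E|%:R / (24 * Num.sqrt d%:R))
    <= \sum_(e in E) expect (fun x => mono_prob e (Z x)).
Proof.
move=> EG; pose m e := expect (fun x => Z x (p e) * Z x (q e)).
have m0 e : 0 <= m e by apply: expect_smooth_mul_ge0; exact: bias_ge0.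
have h0 : 0 <= 2 * (1 / 2) ^+ r :> R by rewrite mulr_ge0 // exprn_ge0 //; lra.
have sd0 : 0 < Num.sqrt d%:R :> R by rewrite sqrtr_gt0 natr_d_gt0.
apply: (@le_trans _ _ (\sum_(e in E) 2 * (1 / 2) ^+ r * (1 + m e))); last first.
  apply: ler_sum => e eE; have [pe qe pqe] := pqE eE.
  rewrite -(E_card eE); apply: expect_mono_prob_ge => //; exact: bias_ge0.
rewrite -mulr_sumr; apply: ler_wpM2l => //.
rewrite big_split /= sumr_const; apply: lerD => //.
(* Edges outside [G] have nonnegative correlation and may be dropped. *)
apply: (@le_trans _ _ (\sum_(e in G) m e)); last first.
  rewrite [X in X <= _]big_mkcond [X in _ <= X]big_mkcond /=; apply: ler_sum => e _.
  by rewrite inE; case: (e \in E) => //=; case: ifP.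
apply: le_trans sum_expect_pairs_ge.
have -> : #|E|%:R / (24 * Num.sqrt d%:R) = (#|E|%:R / 4) / (6 * Num.sqrt d%:R) :> R.
  by field; rewrite gt_eqF.
by apply: ler_wpM2r => //; rewrite invr_ge0 mulr_ge0 // ltW.
Qed.

Lemma expect_sum_bias_sqr_le :
  expect (fun x => (\sum_v Z x v) ^+ 2) <= 4 * d%:R * #|V|%:R.
Proof.
apply: le_trans (expect_sum_smooth_sqr_le bias_ge0) _.
apply: (@le_trans _ _ (\sum_(i : V) 4 * d%:R)); last first.
  by rewrite sumr_const -[X in X <= _]mulr_natr.
apply: ler_sum => i _.
have -> : 4 * d%:R = (2 * Num.sqrt d%:R) ^+ 2 :> R.
  by rewrite exprMn sqr_sqrtr ?ler0n // -natrX.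
have s0 : 0 <= \sum_v bias v i by apply: sumr_ge0 => v _; exact: bias_ge0.
by rewrite ler_sqr ?nnegrE ?sum_bias_le // mulr_ge0 ?sqrtr_ge0.
Qed.

End Bias.

(** * Derandomization with a penalty for imbalance *)

Lemma sum_mul_neq (R : comRingType) (V : finType) (F : V -> R) :
  \sum_u \sum_(v | v != u) F u * F v = (\sum_v F v) ^+ 2 - \sum_v F v ^+ 2.
Proof.
rewrite expr2 mulr_suml -sumrB; apply: eq_bigr => u _.
by rewrite mulr_sumr [in RHS](bigD1 u) //= -expr2 addrC addrK.
Qed.

Lemma exists_sign_vector (R : rcfType) (V : finType) (v0 : V) (E : {set {set V}})
    (r d : nat) (k : R) : (1 < r)%N -> (0 < d)%N -> 0 <= k ->
  (forall e, e \in E -> #|e| = r) -> (forall v, #|[set e in E | v \in e]| = d) ->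
  exists2 y : {ffun V -> R}, cube y &
    2 * (1 / 2) ^+ r * (#|E|%:R + #|E|%:R / (24 * Num.sqrt d%:R))
      - k * (5 * d%:R * #|V|%:R)
    <= \sum_(e in E) mono_prob e y - k * (\sum_v y v) ^+ 2.
Proof.
move=> r1 d0 k0 Er Ed.
pose two (e : {set V}) (uv : V * V) := [&& uv.1 \in e, uv.2 \in e & uv.1 != uv.2].
(* The default [(v0, v0)] is never taken on an edge, as edges have at least two vertices. *)
pose pq (e : {set V}) := odflt (v0, v0) [pick uv | two e uv].
have pqE e : e \in E -> [/\ (pq e).1 \in e, (pq e).2 \in e & (pq e).1 != (pq e).2].
  move=> eE; have : (1 < #|e|)%N by rewrite Er.
  case/card_gt1P => u [v [ue ve uv]].
  rewrite /pq; case: pickP => [w /and3P[? ? ?]|/(_ (u, v))] //.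
  by rewrite /two /= ue ve uv.
have [B BG] := @exists_oriented_half R V E pq pqE.
have := sum_expect_mono_prob_ge Er Ed d0 pqE BG.
have := @expect_sum_bias_sqr_le R V E d Ed d0 pq pqE B.
set Z := smooth _; set h := 2 * _ * _ => varZ monoZ.
(* The squared sum is not multiaffine; replacing its diagonal by [#|V|] makes it so and changes
   nothing on the cube. *)
pose Phi (z : {ffun V -> R}) := \sum_(e in E) mono_prob e z
  + - k * (#|V|%:R + \sum_u \sum_(v | v != u) (0 + 1 * z u) * (0 + 1 * z v)).
have PhiE z : Phi z = \sum_(e in E) mono_prob e z
    - k * (#|V|%:R + ((\sum_v z v) ^+ 2 - \sum_v z v ^+ 2)).
  rewrite /Phi mulNr -sum_mul_neq; congr (_ - _ * (_ + _)).
  by apply: eq_bigr => u _; apply: eq_bigr => v _; rewrite !add0r !mul1r.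
have Phia : multiaffine Phi.
  apply: multiaffineD; first by apply: multiaffine_sum => e _; exact: multiaffine_mono_prob.
  apply/multiaffineZ/multiaffineD; first exact: multiaffine_cst.
  apply: multiaffine_sum => u _; apply: multiaffine_sum => v vu.
  by apply: multiaffine_mul2; rewrite eq_sym.
have [x Phix] := expect_attained (fun x => Phi (Z x)).
have [y cy Phiy] := multiaffine_round Phia (fun v => smooth_bound _ x v : -1 <= Z x v <= 1).
exists y => //.
have -> : \sum_(e in E) mono_prob e y - k * (\sum_v y v) ^+ 2 = Phi y.
  rewrite PhiE (_ : \sum_v y v ^+ 2 = #|V|%:R); first by ring.
  rewrite (eq_bigr (fun=> 1)) ?sumr_const // => v _.
  by case/orP: (cy v) => /eqP ->; rewrite ?sqrrN expr1n.
apply: le_trans (le_trans Phix Phiy).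
apply: (@le_trans _ _ (expect (fun x => \sum_(e in E) mono_prob e (Z x)
   - k * (#|V|%:R + (\sum_v Z x v) ^+ 2)))); last first.
  apply: le_expect => z _; rewrite PhiE lerD2l lerN2; apply: ler_wpM2l => //.
  by rewrite lerD2l gerBl; apply: sumr_ge0 => v _; exact: sqr_ge0.
rewrite expectB expect_sum expectZ expectD expect_cst.
apply: lerB => //; apply: ler_wpM2l => //.
(* The factor 5 is 4 from the variance plus 1 from the diagonal. *)
have : 1 * #|V|%:R <= d%:R * #|V|%:R :> R by apply: ler_wpM2r; rewrite ?ler1n.
lra.
Qed.

(** * Rebalancing a cut and counting incidences *)

Section Balance.
Variables (n d : nat) (E : hypergraph n).
Hypothesis E_deg : regular d E.
Implicit Types (X Y : {set 'I_n}) (v : 'I_n).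

Lemma regular_card v : #|[set e in E | v \in e]| = d.
Proof. by have /forallP/(_ v)/eqP := E_deg. Qed.

Lemma bw_le_cut X : equipartition X -> (bw E <= cut_size E X)%N.
Proof.
rewrite /bw -big_filter => eX.
have : X \in [seq Y <- index_enum _ | equipartition Y].
  by rewrite mem_filter eX mem_index_enum.
elim: (filter _ _) => //= Y s IH; rewrite big_cons inE => /orP[/eqP <-|/IH].
  exact: geq_minl.
by apply: leq_trans; exact: geq_minr.
Qed.

(** Only the [d] edges through [v] can become cut. *)
Lemma cut_size_move X Y v : (forall u, u != v -> (u \in X) = (u \in Y)) ->
  (cut_size E Y <= cut_size E X + d)%N.
Proof.
move=> XY; rewrite -(regular_card v); apply: leq_trans (leq_card_setU _ _).
apply/subset_leq_card/subsetP => e; rewrite !inE => /andP[-> cutY] /=.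
rewrite orbC; case: (boolP (v \in e)) => //= ve.
have eXY u : u \in e -> (u \in X) = (u \in Y).
  by move=> ue; apply: XY; apply: contraNneq ve => <-.
have -> : e :&: X = e :&: Y.
  by apply/setP => u; rewrite !inE; case: (boolP (u \in e)) => //= /eXY.
have -> // : e :\: X = e :\: Y.
by apply/setP => u; rewrite !inE; case: (boolP (u \in e)) => [/eXY ->|]; rewrite ?andbF.
Qed.

(** Moving a vertex off the larger side lowers the difference by two, so [k] moves bring [2 k + 1]
    down to one. *)
Lemma bw_le_cut_add k X : (#|X| <= #|~: X| + k.*2.+1)%N ->
  (#|~: X| <= #|X| + k.*2.+1)%N -> (bw E <= cut_size E X + d * k)%N.
Proof.
elim: k X => [|k IH] X h1 h2.
  by rewrite muln0 addn0 bw_le_cut // /equipartition -addn1 h1 -addn1 h2.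
have [eX|] := boolP (equipartition X).
  exact: leq_trans (bw_le_cut eX) (leq_addr _ _).
have cXC : (#|X| + #|~: X| = n)%N by rewrite cardsC card_ord.
rewrite /equipartition negb_and -!ltnNge => /orP[] h.
  have /card_gt0P[v vX] : (0 < #|X|)%N by lia.
  have := cardsD1 v X; have := cardsC (X :\ v); rewrite vX card_ord => h3 h4.
  have := cut_size_move (X := X) (Y := X :\ v) (v := v).
  have := IH (X :\ v) => /(_ ltac:(lia) ltac:(lia)) h5 h6.
  have : (cut_size E (X :\ v) <= cut_size E X + d)%N.
    by apply: h6 => u uv; rewrite !inE uv.
  rewrite mulnS; lia.
have /card_gt0P[v vX] : (0 < #|~: X|)%N by lia.
have := cardsU1 v X; have := cardsC (v |: X); rewrite inE in vX; rewrite vX card_ord => h3 h4.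
have := cut_size_move (X := X) (Y := v |: X) (v := v).
have := IH (v |: X) => /(_ ltac:(lia) ltac:(lia)) h5 h6.
have : (cut_size E (v |: X) <= cut_size E X + d)%N.
  by apply: h6 => u /negPf uv; rewrite !inE uv.
rewrite mulnS; lia.
Qed.

Lemma handshake r : uniform r E -> (#|E| * r = n * d)%N.
Proof.
move=> Er.
have -> : (#|E| * r = \sum_(e in E) \sum_(v in e) 1)%N.
  rewrite (eq_bigr (fun=> r)) ?sum_nat_const // => e eE; rewrite sum1_card.
  by have /forallP/(_ e)/implyP/(_ eE)/eqP := Er.
have -> : (n * d = \sum_(v : 'I_n) \sum_(e in E | v \in e) 1)%N.
  rewrite (eq_bigr (fun=> d)) ?sum_nat_const ?card_ord // => v _.
  by rewrite -[RHS](regular_card v) -sum1_card; apply: eq_bigl => e; rewrite inE.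
by rewrite (exchange_big_dep xpredT).
Qed.

(** * From sign vectors to bisections *)

Variable R : realFieldType.
Implicit Types y : {ffun 'I_n -> R}.

(** At a sign vector each product indicates that [e] lies on one side; a nonempty edge cannot lie on
    both. *)
Lemma mono_prob_cube y (e : {set 'I_n}) : cube y -> e != set0 ->
  mono_prob e y = (~~ ((e :&: [set v | y v == 1] != set0)
                      && (e :\: [set v | y v == 1] != set0)))%:R.
Proof.
move=> cy e0; set X := [set v | _]; rewrite /mono_prob.
have n1 : (-1 == 1 :> R) = false by rewrite lt_eqF //; lra.
have yX v : y v = if v \in X then 1 else -1.
  by rewrite inE; case/orP: (cy v) => /eqP ->; rewrite ?eqxx ?n1.
have -> : \prod_(v in e) (1 / 2 + 1 / 2 * y v) = (e :\: X == set0)%:R.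
  case: (set_0Vmem (e :\: X)) => [eX|[v]].
    rewrite eX eqxx big1 // => v ve; rewrite yX.
    have : v \notin e :\: X by rewrite eX inE.
    by rewrite !inE ve andbT negbK => ->; field.
  move=> vX; have -> : (e :\: X == set0) = false by apply/set0Pn; exists v.
  move: vX; rewrite in_setD => /andP[vX ve].
  by rewrite (bigD1 v) //= yX (negPf vX); field.
have -> : \prod_(v in e) (1 / 2 + - (1 / 2) * y v) = (e :&: X == set0)%:R.
  case: (set_0Vmem (e :&: X)) => [eX|[v]].
    rewrite eX eqxx big1 // => v ve; rewrite yX.
    have : v \notin e :&: X by rewrite eX inE.
    by rewrite in_setI ve /= => /negPf ->; field.
  move=> vX; have -> : (e :&: X == set0) = false by apply/set0Pn; exists v.
  move: vX; rewrite in_setI => /andP[ve vX].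
  by rewrite (bigD1 v) //= yX vX; field.
case: (eqVneq (e :&: X) set0) => h1; case: (eqVneq (e :\: X) set0) => h2 /=; try by lra.
by rewrite -(setID e X) h1 h2 setU0 eqxx in e0.
Qed.

Lemma sum_mono_prob_cube y : cube y -> (forall e, e \in E -> e != set0) ->
  \sum_(e in E) mono_prob e y = #|E|%:R - (cut_size E [set v | y v == 1])%:R.
Proof.
move=> cy Ene; apply/eqP; rewrite eq_sym subr_eq; apply/eqP.
rewrite /cut_size -!sum1_card !natr_sum [X in _ = _ + X]big_mkcond.
rewrite [X in _ = X + _]big_mkcond [LHS]big_mkcond -big_split /=.
apply: eq_bigr => e _; rewrite inE; case: (boolP (e \in E)) => eE /=; last by rewrite addr0.
by rewrite (mono_prob_cube cy (Ene e eE)); case: (_ && _) => /=; rewrite ?addr0 ?add0r.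
Qed.

Lemma bw_le_mono_prob y : cube y -> (forall e, e \in E -> e != set0) ->
  (bw E)%:R <= #|E|%:R - \sum_(e in E) mono_prob e y + d%:R * (`|\sum_v y v| / 2).
Proof.
move=> cy Ene; rewrite sum_mono_prob_cube //; set X := [set v | _].
have yX v : y v = (v \in X)%:R - (v \in ~: X)%:R.
  have n1 : (-1 == 1 :> R) = false by rewrite lt_eqF //; lra.
  by rewrite !inE; case/orP: (cy v) => /eqP ->; rewrite ?eqxx ?n1 /=; lra.
have -> : \sum_v y v = #|X|%:R - #|~: X|%:R.
  by rewrite (eq_bigr _ (fun v _ => yX v)) sumrB -!sum1_card !natr_sum
    [X in _ = X - _]big_mkcond [X in _ = _ - X]big_mkcond /=;
  congr (_ - _); apply: eq_bigr => v _; case: (_ \in _).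
(* Subtraction is truncated, so [m] is the absolute difference; [m./2] moves suffice. *)
pose m := ((#|X| - #|~: X|) + (#|~: X| - #|X|))%N.
have mE : m%:R = `|#|X|%:R - #|~: X|%:R| :> R.
  rewrite /m; case: (leqP #|X| #|~: X|) => h.
    rewrite (_ : (#|X| - #|~: X| = 0)%N) ?add0n; last by lia.
    by rewrite natrB // distrC ger0_norm // subr_ge0 ler_nat.
  rewrite (_ : (#|~: X| - #|X| = 0)%N) ?addn0; last by lia.
  by rewrite natrB 1?ltnW // ger0_norm // subr_ge0 ler_nat ltnW.
have m2 : (m <= m./2.*2.+1)%N.
  by rewrite -[X in (X <= _)%N]odd_double_half -addn1 addnC leq_add2l; case: odd.
have Xm : (#|X| <= #|~: X| + m)%N by rewrite /m; lia.
have Xm' : (#|~: X| <= #|X| + m)%N by rewrite /m; lia.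
have := @bw_le_cut_add m./2 X (leq_trans Xm _) (leq_trans Xm' _).
rewrite !leq_add2l => /(_ m2 m2).
rewrite -(ler_nat R) natrD natrM -mE => /le_trans; apply.
have : (m./2)%:R <= m%:R / 2 :> R.
  by rewrite ler_pdivlMr // -natrM ler_nat; lia.
move/(ler_wpM2l (ler0n R d)); lra.
Qed.

End Balance.

(** * Choice of constants and conclusion *)

Theorem theorem1p1 (R : realType) (r : nat) (hr : (2 <= r)%N) :
  exists c eps : R, 0 < c /\ 0 < eps /\
    forall (n d : nat) (E : hypergraph n),
      uniform r E -> regular d E ->
      d%:R <= eps * Num.sqrt (n%:R) ->
      (bw E)%:R <= (#|E|)%:R * (1 - 1 / 2 ^+ (r.-1)) - c * Num.sqrt (d%:R) * n%:R.
Proof.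
pose h : R := 2 * (1 / 2) ^+ r.
have hE : 1 / 2 ^+ r.-1 = h.
  have rS : r = r.-1.+1 by lia.
  rewrite /h [in RHS]rS exprS expr_div_n expr1n.
  by lra.
have h0 : 0 < h by rewrite mulr_gt0 // exprn_gt0 //; lra.
have r0 : 0 < r%:R :> R by rewrite ltr0n; lia.
(* With [K] the claimed saving, the gain is [2 * K]. Penalty and rebalancing cost
   [5 / 4 + 1 / 4 = 3 / 2] times [d * s], and [eps] makes [d * s <= 2 / 3 * K], so [K] remains. *)
exists (h / (48 * r%:R)), (h / (72 * r%:R)); split; [|split].
- by rewrite divr_gt0 // mulr_gt0.
- by rewrite divr_gt0 // mulr_gt0.
move=> n d E Er Ed dn; rewrite hE.
have Ecard e : e \in E -> #|e| = r.
  by move=> eE; have /forallP/(_ e)/implyP/(_ eE)/eqP := Er.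
have Ene e : e \in E -> e != set0 by move=> eE; rewrite -card_gt0 Ecard //; lia.
have rE := handshake Ed Er.
case: (posnP d) => [d0|d0].
  have E0 : #|E| = 0%N by move: rE; rewrite d0; nia.
  rewrite d0 sqrtr0 mulr0 mul0r subr0 E0 mul0r.
  suff : (bw E <= #|E|)%N by rewrite E0 leqn0 => /eqP ->.
  rewrite /bw; elim/big_rec: _ => // X b _ bE; exact: leq_trans (geq_minr _ _) bE.
case: n E Er Ed dn Ecard Ene rE => [|n] E Er Ed dn Ecard Ene rE.
  by move: dn; rewrite sqrtr0 mulr0 lern0; lia.
set N := n.+1 in E Er Ed dn Ecard Ene rE *.
set sd := Num.sqrt d%:R; set sn := Num.sqrt N%:R in dn.
have sd0 : 0 < sd by rewrite sqrtr_gt0 ltr0n.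
have sn0 : 0 < sn by rewrite sqrtr_gt0 ltr0n.
have dE : d%:R = sd * sd by rewrite -expr2 sqr_sqrtr ?ler0n.
have nE : N%:R = sn * sn by rewrite -expr2 sqr_sqrtr ?ler0n.
(* The typical imbalance is of order [s = sqrt (d n)]. The penalty weight [d / (4 * s)] matches the
   quadratic term of the rebalancing cost below. *)
pose s := sd * sn; have s0 : 0 < s by rewrite mulr_gt0.
have k0 : 0 <= d%:R / (4 * s) by rewrite divr_ge0 ?ler0n // ltW // mulr_gt0.
have [y cy] := exists_sign_vector (ord0 : 'I_N) hr d0 k0 Ecard (regular_card Ed).
rewrite card_ord -/h -/sd; set M := \sum_v y v; set m := \sum_(e in E) _ => ym.
apply: le_trans (bw_le_mono_prob Ed cy Ene) _; rewrite -/m -/M.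
(* The inequality of arithmetic and geometric means trades the linear cost for the quadratic
   penalty. *)
have Mle : `|M| / 2 <= M ^+ 2 / (4 * s) + s / 4.
  rewrite -[M ^+ 2]real_normK ?num_real //; move: `|M| => t.
  have -> : t ^+ 2 / (4 * s) + s / 4 = t / 2 + (t - s) ^+ 2 / (4 * s).
    by field; rewrite gt_eqF.
  by rewrite lerDl divr_ge0 ?sqr_ge0 // ltW // mulr_gt0.
have : d%:R * (`|M| / 2) <= d%:R / (4 * s) * M ^+ 2 + d%:R * s / 4.
  by have := ler_wpM2l (ler0n R d) Mle; rewrite mulrDr; lra.
have pen : d%:R / (4 * s) * (5 * d%:R * N%:R) = 5 / 4 * (d%:R * s).
  by rewrite /s dE nE; field; rewrite !gt_eqF.
have loss : d%:R * s <= h / (72 * r%:R) * (sd * N%:R).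
  have -> : h / (72 * r%:R) * (sd * N%:R) = (h / (72 * r%:R) * sn) * s.
    by rewrite /s nE; ring.
  by apply: ler_wpM2r dn; exact: ltW.
have gain : h * (#|E|%:R / (24 * sd)) = h / (24 * r%:R) * (sd * N%:R).
  have -> : #|E|%:R = N%:R * d%:R / r%:R :> R.
    by rewrite -natrM -rE natrM mulfK // gt_eqF.
  by rewrite dE; field; rewrite !gt_eqF.
have e1 : h / (24 * r%:R) * (sd * N%:R) = 2 * (h / (48 * r%:R) * sd * N%:R).
  by field; rewrite gt_eqF.
have e2 : h / (72 * r%:R) * (sd * N%:R) = 2 / 3 * (h / (48 * r%:R) * sd * N%:R).
  by field; rewrite gt_eqF.
rewrite e1 in gain; rewrite e2 in loss; rewrite mulrDr gain pen in ym.
set K := h / (48 * r%:R) * sd * N%:R in gain loss ym *.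
rewrite mulrBr mulr1; lra.
Qed.
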